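(* There is a function $\varepsilon(r)$ with $\varepsilon(r)\to 0$ as $r\to\infty$ such that for every sufficiently large integer $r$ there are, for arbitrarily large $d$, $r$-uniform $r$-partite $d$-regular hypergraphs without multiple edges in which no matching covers more than a $(1+\varepsilon(r))\frac{1}{r}$ fraction of the vertices. This is asymptotically tight: every $r$-uniform $d$-regular hypergraph on $n$ vertices ($r\ge 2$, $d\geq 1$) contains a matching that covers at least $\frac{nd}{1+(d-1)r}>\frac{n}{r}$ vertices.
   Context: An $r$-uniform $r$-partite hypergraph is one whose vertex set is partitioned into $r$ classes such that each edge consists of exactly one vertex from each class. It is $d$-regular if every vertex lies in exactly $d$ edges. A matching is a set of pairwise disjoint edges. *)

(* Defs.v *)
From mathcomp Require Import all_boot.

Set Implicit Arguments.
Unset Strict Implicit.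
Unset Printing Implicit Defensive.

(* Edges are an indexed family of vertex sets, so that a hypergraph may have
   multiple edges; those without are singled out by [simple]. *)
Record hypergraph := Hypergraph {
  vertex : finType;
  edge : finType;
  verts : edge -> {set vertex}
}.

Section Hypergraph.
Variable H : hypergraph.

Definition simple : Prop := injective (@verts H).

Definition uniform (r : nat) : Prop := forall e : edge H, #|verts e| = r.

(* Edges are counted with multiplicity. *)
Definition regular (d : nat) : Prop :=
  forall v : vertex H, #|[set e : edge H | v \in verts e]| = d.

(* The fibres of [c] are the [r] vertex classes. *)
Definition partite (r : nat) : Prop :=
  exists c : vertex H -> 'I_r,
    forall (e : edge H) (i : 'I_r), #|[set v in verts e | c v == i]| = 1.

Definition matching (M : {set edge H}) : Prop :=
  {in M &, forall e f, e != f -> [disjoint verts e & verts f]}.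

Definition covered (M : {set edge H}) : {set vertex H} :=
  \bigcup_(e in M) verts e.

End Hypergraph.

(* Main.v *)
(** Call a family of maps from X to a set of N values, all fibres having size p,
    a covering system if any two points of X collide under some map.  With the
    maps as vertex classes and the points as edges this is an intersecting
    p-regular hypergraph.  For p prime and N prime to (p-1)!, the pN maps
    (i, x) |-> x + a i on {0..p-1} * Z/pN make all points with distinct i
    collide, and points with equal i are handled recursively; so N grows to pN
    at the price of only pN more maps.  Starting from a trivial system with
    N = 1 + q (p-1)!, this gives N >= (1 - O(1/p)) r for all large numbers r of
    maps, without any information on prime gaps.

    Taking d = pT disjoint copies of the system with every edge repeated T
    times, and one more class in which the copies of the edge (x, t) from all
    the systems share a vertex, makes the hypergraph simple.  A matching has at
    most one edge in each copy, so it covers at most 1/N of the vertices.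

    The lower bound is greedy: an edge meets at most (d-1) r others. *)
Require Import Defs.
From mathcomp Require Import all_boot all_order all_algebra all_fingroup.
From mathcomp Require Import zify.
Import Order.TTheory GRing.Theory Num.Theory.

Set Implicit Arguments.
Unset Strict Implicit.
Unset Printing Implicit Defensive.

(** * Covering systems: trivial system, recursive step, choice of parameters *)

Lemma bij_of_card (A B : finType) :
  #|A| = #|B| -> exists (f : A -> B) (g : B -> A), cancel f g /\ cancel g f.
Proof.
move=> eAB.
exists (fun a => enum_val (cast_ord eAB (enum_rank a))).
exists (fun b => enum_val (cast_ord (esym eAB) (enum_rank b))).
by split=> x; rewrite enum_valK ?cast_ordK ?cast_ordKV enum_rankK.
Qed.

Definition covering_system (p N m : nat) : Prop :=
  exists (X J V : finType) (c : J -> X -> V),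
    [/\ #|X| = p * N, #|V| = N, #|J| <= m,
        forall j v, #|[set x | c j x == v]| = p
      & forall x y, exists j, c j x = c j y].

(* One map for each pair of points, sending this pair to a common value. *)
Lemma covering_system_base (p N : nat) :
  1 < p -> 0 < N -> covering_system p N ((p * N) ^ 2).
Proof.
move=> p1 N0; pose X := ('I_N * 'I_p)%type.
have p0 : 0 < p by lia.
pose z0 : X := (Ordinal N0, Ordinal p0); pose z1 : X := (Ordinal N0, Ordinal p1).
(* For the pair of [x] and [y], the permutation takes [x] to [z0] and any [y] other than [x] to
   [z1]; these two agree in the first coordinate. Bijectivity keeps the fibres of size [p]. *)
pose s (xy : X * X) : {perm X} :=
  (tperm xy.1 z0 * tperm (tperm xy.1 z0 xy.2) z1)%g.
exists X, (X * X)%type, 'I_N, (fun xy z => (s xy z).1).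
split=> [|||xy v|x y].
- by rewrite card_prod !card_ord mulnC.
- exact: card_ord.
- by rewrite !card_prod !card_ord (mulnC N) mulnn.
- have -> : [set x | (s xy x).1 == v] = s xy @^-1: setX [set v] setT.
    by apply/setP => x; rewrite !inE ?andbT.
  rewrite card_preimset; last exact: perm_inj.
  by rewrite cardsX cards1 cardsT card_ord mul1n.
- exists (x, y); have [->|xy] := eqVneq x y; first by [].
  have yz0 : tperm x z0 y != z0.
    by apply: contra_neq xy => /(canRL (tpermK x z0)); rewrite tpermR.
  by rewrite /s /= !permM !tpermL (tpermD yz0).
Qed.

Lemma covering_system_step (p N m : nat) :
    1 < p * N -> (forall i, 0 < i < p -> coprime (p * N) i) ->
  covering_system p N m -> covering_system p (p * N) (m + p * N).
Proof.
move=> pN1 cop [X [J [V [c [cX cV cJ cfib cpair]]]]].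
pose G := 'Z_(p * N).
have cG : #|G| = p * N by rewrite card_ord Zp_cast.
have [h [h' [hK h'K]]] : exists (h : X -> G) (h' : G -> X), cancel h h' /\ cancel h' h.
  by apply: bij_of_card; rewrite cG.
have [k [k' [kK k'K]]] : exists (k : G -> 'I_p * V) k', cancel k k' /\ cancel k' k.
  by apply: bij_of_card; rewrite cG card_prod card_ord cV.
pose c' (j : J + G) (z : 'I_p * X) : 'I_p * V :=
  match j with
  | inl j => (z.1, c j z.2)
  | inr a => k (h z.2 + a *+ z.1)%R
  end.
exists ('I_p * X)%type, (J + G)%type, ('I_p * V)%type, c'; split.
- by rewrite card_prod card_ord cX.
- by rewrite card_prod card_ord cV.
- by rewrite card_sum cG leq_add2r.
- case=> [j|a] v /=.
    have -> : [set x | c' (inl j) x == v] = setX [set v.1] [set x | c j x == v.2].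
      by apply/setP => x; rewrite !inE.
    by rewrite cardsX cards1 cfib mul1n.
  have -> : [set x | c' (inr a) x == v]
      = [set (i, h' (k' v - a *+ i)%R) | i : 'I_p].
    apply/setP => -[i x]; rewrite inE /=; apply/eqP/imsetP => [<-|[i' _ [-> ->]]].
      by exists i => //; rewrite kK addrK hK.
    by rewrite h'K subrK k'K.
  by rewrite card_imset ?card_ord // => i i' [].
- suff main : forall (i i' : 'I_p) x y, i <= i' ->
      exists j, c' j (i, x) = c' j (i', y).
    move=> [i x] [i' y]; case: (leqP i i') => [/main//|/ltnW/main].
    by move=> /(_ y x) [j ej]; exists j.
  move=> i i' x y; rewrite leq_eqVlt => /orP[/eqP/val_inj <-|ltii'].
    by have [j ej] := cpair x y; exists (inl j); rewrite /= ej.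
  (* A collision means [h x + a i = h y + a i']. This is solvable for [a], since [0 < i' - i < p] is
     prime to [p * N]. *)
  have u : ((i' - i)%:R : G)%R \is a GRing.unit.
    by rewrite unitZpE // cop // subn_gt0 ltii' /=; have := ltn_ord i'; lia.
  pose a := ((h x - h y) / (i' - i)%:R)%R.
  have ea : (a *+ (i' - i) = h x - h y)%R by rewrite -mulr_natr divrK.
  exists (inr a); rewrite /=; congr k.
  by rewrite -(subnK (ltnW ltii')) mulrnDr ea addrA addrCA subrr addr0.
Qed.

(** Passing from [p ^ i * N] to [p ^ i.+1 * N] costs [p ^ i.+1 * N] maps, and further factors [p]
    bring in no new prime, so coprimality persists. *)
Lemma covering_system_iter (p N m k : nat) :
    1 < p -> 0 < N -> (forall i, 0 < i < p -> coprime (p * N) i) ->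
  covering_system p N m ->
  covering_system p (p ^ k * N) (m + \sum_(i < k) p ^ i.+1 * N).
Proof.
move=> p1 N0 cop sys; elim: k => [|k IHk]; first by rewrite big_ord0 addn0 mul1n.
have pk0 : 0 < p ^ k by rewrite expn_gt0; lia.
rewrite big_ord_recr /= addnA expnS -mulnA; apply: covering_system_step => //.
  by nia.
move=> i ip; have := cop i ip; rewrite !coprimeMl => /andP[ci ->].
by rewrite ci andbT coprimeXl.
Qed.

Lemma covering_system_exists (n : nat) :
  exists r0, forall r, r0 <= r ->
    exists p N m, [/\ 0 < p, 0 < N, m < r, n * r <= n.+1 * N
      & covering_system p N m].
Proof.
have [p pn pp] := prime_above (2 * n + 3).
have [F eF] : exists F, F = (p.-1)`! by exists (p.-1)`!.
have p1 : 1 < p by exact: prime_gt1.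
have F0 : 0 < F by rewrite eF fact_gt0.
have [B eB] : exists B, B = p * (1 + p.-1 * F) by eexists.
have [C eC] : exists C, C = (p * B) ^ 2 by eexists.
(* [B] will bound the initial [N], and [C] the number of maps of the trivial system. The first
   summand makes [C + 1] negligible against [A]; the last makes [k = 0] admissible. *)
exists (n.+1 * p * (C + 1) + C + 1 + p * B) => r r_ge.
have [A Ar] : exists A, r = A + C + 1 by exists (r - C - 1); lia.
(* [A] bounds the number of maps left for the recursive steps; the resulting
   [N] is [p ^ k * (1 + q * (p-1)!)], with [k] and then [q] maximal subject to
   [p * N <= (p-1) * A].  Maximality of [k] keeps [q] bounded independently of
   [r], so that [C] pays for the trivial system. *)
have [k [kA Ak]] : exists k, p ^ k.+1 * (1 + p.-1 * F) <= p.-1 * A /\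
    p.-1 * A < p ^ k.+2 * (1 + p.-1 * F).
  have ex0 : exists k, p ^ k.+1 * (1 + p.-1 * F) <= p.-1 * A.
    exists 0; rewrite expn1 -eB; have BA : B <= A.
      by have : B <= p * B by [rewrite leq_pmull //; lia]; lia.
    by apply: leq_trans BA _; apply: leq_pmull; lia.
  have ub k : p ^ k.+1 * (1 + p.-1 * F) <= p.-1 * A -> k <= p.-1 * A.
    apply: leq_trans; apply: leq_trans (leq_pmulr _ _) => //.
    by rewrite ltnW // ltnW // ltn_expl.
  case: (ex_maxnP ex0 ub) => k kA kmax; exists k; split=> //.
  by rewrite ltnNge; apply/negP => /kmax; rewrite ltnn.
have pk0 i : 0 < p ^ i by rewrite expn_gt0 ltnW.
have [q [qA Aq]] : exists q, p ^ k.+1 * (1 + q * F) <= p.-1 * A /\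
    p.-1 * A < p ^ k.+1 * (1 + q.+1 * F).
  have ex0 : exists q, p ^ k.+1 * (1 + q * F) <= p.-1 * A by exists p.-1.
  have ub q : p ^ k.+1 * (1 + q * F) <= p.-1 * A -> q <= p.-1 * A.
    apply: leq_trans; apply: leq_trans (leq_pmull _ _) => //.
    by rewrite addnC (leq_trans (leq_pmulr q F0)) ?leq_addr.
  case: (ex_maxnP ex0 ub) => q qA qmax; exists q; split=> //.
  by rewrite ltnNge; apply/negP => /qmax; rewrite ltnn.
(* Hence [p.-1 * F <= U]: rounding to the form [1 + q * F] loses a fraction of at most 1/(p-1). *)
have pq : p.-1 <= q.
  have : p ^ k.+1 * (1 + p.-1 * F) < p ^ k.+1 * (1 + q.+1 * F) by lia.
  by rewrite ltn_pmul2l // ltn_add2l ltn_pmul2r.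
pose U := 1 + q * F.
have UB : U < B.
  have : p ^ k.+1 * U < p ^ k.+1 * B by rewrite eB mulnA -expnSr; lia.
  by rewrite ltn_pmul2l.
(* Each such [i] divides [F], so [U] is 1 modulo [i]. *)
have cop i : 0 < i < p -> coprime (p * U) i.
  move=> /andP[i0 ip]; rewrite coprimeMl prime_coprime // gtnNdvd //=.
  have /dvdnP[a Fa] : i %| F by rewrite eF; apply: dvdn_fact; lia.
  rewrite /U Fa mulnA addnC coprime_sym; rewrite /coprime gcdnMDl.
  by rewrite gcdn1.
pose E := \sum_(i < k) p ^ i.+1 * U.
(* A geometric sum: [p.-1 * E] is below [p ^ k.+1 * U], hence below [p.-1 * A]. *)
have EA : E <= A.
  have eE : p.-1 * E + p * U = p ^ k.+1 * U.
    rewrite /E; elim: (k) => [|l IHl]; first by rewrite big_ord0 muln0 expn1.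
    rewrite big_ord_recr /= mulnDr addnAC IHl -mulSn prednK; last lia.
    by rewrite mulnA -expnS.
  have : p.-1 * E <= p.-1 * A by rewrite -/U in qA; lia.
  by rewrite leq_pmul2l //; lia.
exists p, (p ^ k * U), ((p * U) ^ 2 + E); split.
- exact: ltnW.
- by rewrite muln_gt0 pk0.
- have : (p * U) ^ 2 <= C by rewrite eC leq_exp2r // leq_mul2l ltnW ?orbT.
  lia.
- have [P pP] : exists P, p = P.+1 by exists p.-1; lia.
  (* Maximality of [q] bounds [P * A] by [p ^ k.+1 * (U + F)]; multiply by [P] and use
     [P * F <= U]. *)
  set N := p ^ k * U; have ltN : P * (P * A) <= p * (p * N).
    have -> : p * (p * N) = P * (p * N) + p * (p ^ k * U) by rewrite /N pP mulSn addnC.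
    have PFU : P * F <= U by rewrite /U; have := leq_mul pq (leqnn F); rewrite pP /=; lia.
    have Aq' : P * A <= p * p ^ k * (U + F).
      by move: Aq; rewrite pP /= -pP -expnS /U mulSn addnCA addnC => /ltnW.
    have := leq_mul (leqnn (p * p ^ k)) PFU; have := leq_mul (leqnn P) Aq'.
    by rewrite /N; lia.
  have le1 : p * A <= p * N + 2 * A.
    have : p * (p * A) <= p * (p * N + 2 * A) by rewrite pP in ltN *; lia.
    by rewrite leq_pmul2l //; lia.
  have le2 : n * p * (C + 1) <= A.
    have : n.+1 * p * (C + 1) <= A + C + 1 by lia.
    have : C + 1 <= p * (C + 1) by rewrite leq_pmull //; lia.
    by lia.
  (* By [le1], [N] is at least (1 - 2/p)A. As [p > 2n + 3], the loss of [2(n+1)A] leaves a spare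
     [A], which pays for [n * p * (C + 1)]. *)
  suff : p * (n * r) <= p * (n.+1 * N) by rewrite leq_pmul2l //; lia.
  have le3 : (2 * n + 3) * A <= p * A by rewrite leq_mul2r ltnW ?orbT.
  have := leq_mul (leqnn n.+1) le1.
  by rewrite Ar; lia.
- apply: covering_system_iter => //.
  by apply: covering_system_base.
Qed.

(** * Hypergraphs given by one map on the edges per vertex class *)

Definition class_hypergraph (r : nat) (E W : finType) (k : 'I_r -> E -> W) :=
  @Hypergraph ('I_r * W)%type E (fun e => [set (i, k i e) | i : 'I_r]).

Section ClassHypergraph.
Variables (r : nat) (E W : finType) (k : 'I_r -> E -> W).
Let H := class_hypergraph k.

Lemma mem_class_hypergraph (e : edge H) (i : 'I_r) (w : W) :
  ((i, w) \in verts e) = (k i e == w).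
Proof. by apply/imsetP/eqP => [[j _ [-> ->]]|<-] //; exists i. Qed.

Lemma class_hypergraph_uniform : uniform H r.
Proof. by move=> e; rewrite card_imset ?card_ord // => i j []. Qed.

Lemma class_hypergraph_partite : partite H r.
Proof.
exists (fun v => v.1) => e i; rewrite -(cards1 (i, k i e)); congr #|pred_of_set _|.
apply/setP => -[j w]; rewrite !inE mem_class_hypergraph xpair_eqE andbC.
by rewrite (eq_sym w); case: (eqVneq j i) => [->|].
Qed.

Lemma class_hypergraph_regular (d : nat) :
  (forall i w, #|[set e | k i e == w]| = d) -> regular H d.
Proof.
move=> fib [i w]; rewrite -(fib i w); congr #|pred_of_set _|.
by apply/setP => e; rewrite !inE mem_class_hypergraph.
Qed.

Lemma class_hypergraph_simple :
  (forall e f, (forall i, k i e = k i f) -> e = f) -> simple H.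
Proof.
move=> inj e f ef; apply: inj => i; apply/eqP.
by rewrite -(mem_class_hypergraph e) ef mem_class_hypergraph.
Qed.

Lemma class_hypergraph_disjoint (i : 'I_r) (e f : edge H) :
  [disjoint verts e & verts f] -> k i e <> k i f.
Proof.
move=> /pred0P/(_ (i, k i e))/=; rewrite !mem_class_hypergraph eqxx /=.
by move=> /eqP ne ef; apply: ne; rewrite ef.
Qed.

End ClassHypergraph.

(** * Sizes of matchings: the construction and the greedy bound *)

Lemma card_bigcup_le (I T : finType) (P : pred I) (F : I -> {set T}) :
  #|\bigcup_(i | P i) F i| <= \sum_(i | P i) #|F i|.
Proof.
elim/big_rec2: _ => [|i n A _ leAn]; first by rewrite cards0.
by apply: leq_trans (leq_card_setU _ _).1 _; rewrite leq_add2l.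
Qed.

Lemma card_covered (H : hypergraph) (r : nat) (M : {set edge H}) :
  uniform H r -> matching M -> #|covered M| = #|M| * r.
Proof.
move=> unif matchM; rewrite /covered big_mkcond -sum1_card.
rewrite partition_disjoint_bigcup => [|e f ef].
  rewrite -sum_nat_const [RHS]big_mkcond; apply: eq_bigr => e _.
  by case: ifP => _; rewrite sum1_card ?unif ?cards0.
case: ifP => eM; last by rewrite -setI_eq0 set0I.
by case: ifP => fM; [exact: matchM | rewrite -setI_eq0 setI0].
Qed.

Lemma small_matching_hypergraph (p N m r D : nat) :
    0 < p -> 0 < N -> m < r -> covering_system p N m ->
  exists d, D <= d /\ exists H : hypergraph,
    [/\ 0 < #|vertex H|, simple H, uniform H r, partite H r & regular H d] /\
    forall M : {set edge H}, matching M -> #|covered M| * N <= #|vertex H|.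
Proof.
move=> p0 N0; case: r => // r; rewrite ltnS => mr [X [J [V [c [cX cV cJ fib cpair]]]]].
have [d ed] : exists d, d = p * D.+1 by eexists.
exists d; split; first by rewrite ed (leq_trans (leqnSn D)) // leq_pmull.
have d0 : 0 < d by rewrite ed muln_gt0 p0.
have [x0 _] : exists x : X, x \in setT by apply/set0Pn; rewrite -card_gt0 cardsT cX; nia.
have [j0 _] := cpair x0 x0.
(* The maps are listed as classes; surplus classes repeat [j0]. *)
pose f (i : 'I_r) : J := nth j0 (enum J) i.
have f_surj j : exists i, f i = j.
  have lt : index j (enum J) < r.
    by apply: leq_trans mr; apply: leq_trans cJ; rewrite cardE index_mem mem_enum.
  by exists (Ordinal lt); rewrite /f nth_index // mem_enum.
have [g [g' [gK g'K]]] : exists (g : X * 'I_D.+1 -> 'I_d * V) g', cancel g g' /\ cancel g' g.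
  by apply: bij_of_card; rewrite !card_prod !card_ord cX cV ed mulnAC.
pose E := ('I_d * (X * 'I_D.+1))%type.
(* An edge is a copy number, a point and a repetition index. Ordinary classes keep the copy number;
   the last one forgets it but determines the rest through [g], so its vertices have one edge from
   each of the [d] copies. *)
pose k (i : 'I_r.+1) (e : E) : 'I_d * V :=
  if unlift ord_max i is Some j then (e.1, c (f j) e.2.1) else g e.2.
have i0 : 0 < r by have [i _] := f_surj j0; apply: leq_ltn_trans (ltn_ord i).
pose H := class_hypergraph k.
have k_lift j e : k (lift ord_max j) e = (e.1, c (f j) e.2.1) by rewrite /k liftK.
have k_max e : k ord_max e = g e.2 by rewrite /k unlift_none.
exists H; split; first split.
- by rewrite !card_prod !card_ord cV !muln_gt0 d0.
- apply: class_hypergraph_simple => e e' ee'.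
  have := ee' ord_max; rewrite !k_max => /(can_inj gK).
  have := ee' (lift ord_max (Ordinal i0)); rewrite !k_lift => -[].
  by case: e e' {ee'} => [b z] [b' z'] /= -> _ ->.
- exact: class_hypergraph_uniform.
- exact: class_hypergraph_partite.
- apply: class_hypergraph_regular => i w; case: (unliftP ord_max i) => [j|] ->.
    have -> : [set e | k (lift ord_max j) e == w]
        = setX [set w.1] (setX [set x | c (f j) x == w.2] setT).
      by apply/setP => -[b [x t]]; rewrite !inE k_lift /= andbT -pair_eqE.
    by rewrite !cardsX cards1 fib cardsT card_ord mul1n.
  have -> : [set e | k ord_max e == w] = setX setT [set g' w].
    by apply/setP => e; rewrite !inE k_max /= (can2_eq gK g'K).
  by rewrite cardsX cards1 cardsT card_ord muln1.
- move=> M matchM.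
  have cM : #|M| <= d.
    rewrite -(card_ord d) -(@card_in_imset _ _ (fun e : E => e.1)) ?max_card //.
    move=> e e' eM e'M ee'; apply/eqP/negPn/negP => /(matchM e e' eM e'M).
    have [j cj] := cpair e.2.1 e'.2.1; have [i fi] := f_surj j.
    by move/(@class_hypergraph_disjoint _ _ _ k (lift ord_max i)); apply; rewrite !k_lift fi ee' cj.
  rewrite (card_covered (@class_hypergraph_uniform _ _ _ k) matchM).
  have -> : #|vertex H| = r.+1 * (d * N) by rewrite !card_prod !card_ord cV.
  by rewrite mulnAC mulnC leq_pmul2l // leq_pmul2r.
Qed.

(** In a maximal matching every edge is or meets a chosen one, so the sets [nbh f] cover all edges.
    Counting incidences gives [#|vertex H| * d = #|edge H| * r]. *)
Lemma greedy_matching (H : hypergraph) (r d : nat) :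
    0 < r -> 0 < d -> uniform H r -> regular H d ->
  exists M : {set edge H}, matching M /\
    #|vertex H| * d <= #|covered M| * (1 + d.-1 * r).
Proof.
move=> r0 d0 unif reg.
pose disj (M : {set edge H}) :=
  [forall e in M, forall f in M, (e != f) ==> [disjoint verts e & verts f]].
have disjP M : reflect (matching M) (disj M).
  apply: (iffP forall_inP) => [h e f eM fM ef|h e eM].
    by have /forall_inP/(_ f fM)/implyP/(_ ef) := h e eM.
  by apply/forall_inP => f fM; apply/implyP/h.
have disj0 : disj set0 by apply/disjP => e f; rewrite inE.
have [M /maxsetP[/disjP matchM maxM] _] := maxset_exists disj0.
exists M; split=> //.
pose nbh (f : edge H) := f |: \bigcup_(v in verts f) ([set e | v \in verts e] :\ f).
have cover_nbh e : e \in \bigcup_(f in M) nbh f.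
  case: (boolP (e \in M)) => [eM|eM].
    by apply/bigcupP; exists e => //; rewrite !inE eqxx.
  have : ~~ disj (e |: M).
    apply: contra eM => dM; rewrite -(maxM _ dM) ?subsetUr //.
    by rewrite !inE eqxx.
  apply: contraR => /negP noM; apply/disjP => e1 e2; rewrite !inE.
  have disj_e f : f \in M -> [disjoint verts e & verts f].
    move=> fM; apply/pred0P => v /=; apply/negP => /andP[ve vf]; apply: noM.
    apply/bigcupP; exists f => //; rewrite !inE; apply/orP; right; apply/bigcupP; exists v => //.
    by rewrite !inE ve andbT; apply: contraNneq eM => ->.
  move=> /orP[/eqP->|e1M] /orP[/eqP->|e2M]; first by rewrite eqxx.
  - by move=> _; exact: disj_e.
  - by move=> _; rewrite disjoint_sym; exact: disj_e.
  - exact: matchM.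
have card_nbh f : #|nbh f| <= 1 + d.-1 * r.
  rewrite cardsU1; apply: leq_add; first by case: (_ \notin _).
  apply: leq_trans (card_bigcup_le _ _) _.
  rewrite (eq_bigr (fun=> d.-1)) ?sum_nat_const ?unif ?(mulnC r) // => v vf.
  by rewrite -(reg v) (cardsD1 f [set e | v \in verts e]) inE vf.
have cardE : #|edge H| <= #|M| * (1 + d.-1 * r).
  rewrite -cardsT -sum_nat_const; apply: (@leq_trans (\sum_(f in M) #|nbh f|)); last exact: leq_sum.
  apply: leq_trans (card_bigcup_le _ _); apply: subset_leq_card.
  by apply/subsetP => e _; exact: cover_nbh.
have -> : #|vertex H| * d = #|edge H| * r.
  transitivity (\sum_(v : vertex H) \sum_(e | v \in verts e) 1).
    rewrite -sum_nat_const; apply: eq_bigr => v _.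
    by rewrite -(reg v) -sum1_card; apply: eq_bigl => e; rewrite inE.
  rewrite (exchange_big_dep xpredT) //= -sum_nat_const.
  by apply: eq_bigr => e _; rewrite sum1_card unif.
by rewrite (card_covered unif matchM) mulnAC leq_mul2r cardE orbT.
Qed.

(* The error function, its limit, and the real inequalities *)
From mathcomp Require Import all_classical all_reals all_analysis.
Import numFieldNormedType.Exports.

(** Take for [k r] the largest [i <= r] whose threshold [f i] is at most [r]; from [f 0] on, such an
    [i] exists. *)
Lemma diagonal_choice (P : nat -> nat -> Prop) :
    (forall n, exists r0, forall r, r0 <= r -> P n r) ->
  exists k : nat -> nat, (exists r0, forall r, r0 <= r -> P (k r) r) /\
    forall n, exists r0, forall r, r0 <= r -> n <= k r.
Proof.
move=> /choice[f fP].
exists (fun r => \max_(i < r.+1 | f i <= r) i); split.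
  exists (f 0) => r f0r.
  have [|i fi ->] := @eq_bigmax_cond _ [pred i : 'I_r.+1 | f i <= r] (@nat_of_ord _).
    by apply/card_gt0P; exists ord0.
  exact: fP.
move=> n; exists (maxn n (f n)) => r; rewrite geq_max => /andP[nr fr].
exact: (@leq_bigmax_cond _ (fun i : 'I_r.+1 => f i <= r) (@nat_of_ord _)
          (Ordinal (nr : n < r.+1))).
Qed.

Local Open Scope classical_set_scope.
Local Open Scope ring_scope.

Theorem mainTheorem7 (R : realType) :
  (exists eps : nat -> R,
     eps r @[r --> \oo] --> (0 : R) /\
     exists r0 : nat, forall r : nat, (r0 <= r)%N ->
       forall D : nat, exists d : nat, (D <= d)%N /\
         exists H : hypergraph,
           [/\ (0 < #|vertex H|)%N, simple H, uniform H r, partite H r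
             & regular H d] /\
           forall M : {set edge H}, matching M ->
             #|covered M|%:R / #|vertex H|%:R <= (1 + eps r) * (1 / r%:R))
  /\
  (forall (r d n : nat) (H : hypergraph),
     (2 <= r)%N -> (1 <= d)%N -> (0 < n)%N ->
     #|vertex H| = n -> uniform H r -> regular H d ->
     (exists M : {set edge H}, matching M /\
        n%:R * d%:R / (1 + (d%:R - 1) * r%:R) <= #|covered M|%:R :> R) /\
     n%:R / r%:R < n%:R * d%:R / (1 + (d%:R - 1) * r%:R) :> R).
Proof.
split; last first.
  move=> r d n H r2 d1 n0 cH unif reg.
  have den : 1 + (d%:R - 1) * r%:R = (1 + d.-1 * r)%:R :> R.
    by rewrite natrD natrM -subn1 natrB.
  have den0 : 0 < (1 + d.-1 * r)%:R :> R by rewrite ltr0n.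
  rewrite den; split.
    have [M [matchM le]] := greedy_matching (ltnW r2) d1 unif reg.
    by exists M; split=> //; rewrite ler_pdivrMr // -!natrM ler_nat -cH.
  rewrite ltr_pdivrMr ?ltr0n ?(ltnW r2) // mulrAC ltr_pdivlMr // -!natrM ltr_nat.
  (* What remains is [1 + (d-1)r < dr], that is [1 < r]. *)
  by rewrite -mulnA ltn_pmul2l //; nia.
pose good n r := forall D, exists d, (D <= d)%N /\ exists H : hypergraph,
  [/\ (0 < #|vertex H|)%N, simple H, uniform H r, partite H r & regular H d] /\
  forall M : {set edge H}, matching M ->
    #|covered M|%:R / #|vertex H|%:R <= (1 + n.+1%:R^-1) * (1 / r%:R) :> R.
have [k [[r0 k_good] k_cvg]] : exists k : nat -> nat,
    (exists r0, forall r, (r0 <= r)%N -> good (k r) r) /\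
    forall n, exists r0, forall r, (r0 <= r)%N -> (n <= k r)%N.
  (* With [n.+1] the ratio is (n+2)/(n+1), which is exactly [1 + n.+1%:R^-1]. *)
  apply: diagonal_choice => n; have [r0 sys] := covering_system_exists n.+1.
  exists r0 => r /sys[p [N [m [p0 N0 mr nrN cov]]]] D.
  have [d [Dd [H [Hprops covM]]]] := small_matching_hypergraph D p0 N0 mr cov.
  exists d; split=> //; exists H; split=> // M /covM {covM} le.
  have [v0 _ _ _ _] := Hprops.
  apply: (@le_trans _ _ N%:R^-1).
    by rewrite ler_pdivrMr ?ltr0n // mulrC ler_pdivlMr ?ltr0n // -natrM ler_nat.
  have r0' : (0 < r)%N by exact: leq_ltn_trans mr.
  rewrite div1r ler_pdivlMr ?ltr0n // mulrC ler_pdivrMr ?ltr0n //.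
  have -> : 1 + n.+1%:R^-1 = n.+2%:R / n.+1%:R :> R.
    by rewrite -[n.+2]addn1 natrD mulrDl divff ?pnatr_eq0 // div1r.
  by rewrite mulrAC ler_pdivlMr ?ltr0n // -!natrM ler_nat mulnC.
exists (fun r => (k r).+1%:R^-1); split; last by exists r0.
apply: (@cvg_comp _ _ _ k harmonic _ \oo); last exact: cvg_harmonic.
apply/cvgnyPge => n; have [r1 kr1] := k_cvg n.
by exists r1.
Qed.
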